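(* Let $\mathbb{F}$ be a division ring, $n$ a positive integer, $\sigma:\mathbb{F}\to\mathbb{F}^{n\times n}$ a ring morphism and $\delta:\mathbb{F}\to\mathbb{F}^n$ a $\sigma$-derivation. If $\Omega\subseteq\mathbb{F}^n$ is P-closed and finitely generated, then so is $\Omega\cap\mathcal{C}(\mathbf{a})$ for all $\mathbf{a}\in\mathbb{F}^n$. Conversely, if the sets $\Omega_i\subseteq\mathcal{C}(\mathbf{a}_i)$ are P-closed and finitely generated, for $i=1,2,\dots,\ell$, where $\mathbf{a}_1,\mathbf{a}_2,\dots,\mathbf{a}_\ell\in\mathbb{F}^n$ are pairwise non-conjugate, then $\Omega=\Omega_1\cup\Omega_2\cup\dots\cup\Omega_\ell$ is P-closed and finitely generated. In addition, if $\mathcal{B}_i$ is a P-basis of $\Omega_i$, for $i=1,\dots,\ell$, then $\mathcal{B}=\mathcal{B}_1\cup\mathcal{B}_2\cup\dots\cup\mathcal{B}_\ell$ is a P-basis of $\Omega$, and in particular $$\mathrm{Rk}(\Omega)=\mathrm{Rk}(\Omega_1)+\mathrm{Rk}(\Omega_2)+\cdots+\mathrm{Rk}(\Omega_\ell).$$ Moreover, the collection of finitely generated P-closed subsets of $\mathcal{C}(\mathbf{a}_1)\cup\mathcal{C}(\mathbf{a}_2)\cup\dots\cup\mathcal{C}(\mathbf{a}_\ell)$ forms a lattice (with sums and intersections) isomorphic to the Cartesian product of the lattices of finite-dimensional right $K_{\mathbf{a}_i}$-linear projective subspaces of $\mathbb{P}^R_{K_{\mathbf{a}_i}}(\mathbb{F})$,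 for $i=1,2,\dots,\ell$.
   Context: Rings are associative with identity, not necessarily commutative, and ring morphisms preserve identities. $\mathbb{F}^*=\mathbb{F}\setminus\{0\}$ and $\mathbb{F}^n$ denotes column vectors. A map $\delta:\mathbb{F}\to\mathbb{F}^n$ is a $\sigma$-derivation if $\delta(a+b)=\delta(a)+\delta(b)$ and $\delta(ab)=\sigma(a)\delta(b)+\delta(a)b$ for all $a,b\in\mathbb{F}$. Free skew polynomial ring: let $\mathcal{M}$ be the free monoid on pairwise distinct variables $x_1,\dots,x_n$. $\mathbb{F}[\mathbf{x};\sigma,\delta]$ is the left $\mathbb{F}$-vector space with basis $\mathcal{M}$, with the ring product given by concatenating monomials and $x_i a=\sum_{j=1}^n\sigma_{i,j}(a)x_j+\delta_i(a)$ for $a\in\mathbb{F}$. Skew evaluation: for $\mathbf{a}=(a_1,\dots,a_n)\in\mathbb{F}^n$, $F(\mathbf{a})$ is the unique element of $\mathbb{F}$ such that $F-F(\mathbf{a})$ belongs to the left ideal generated by $x_1-a_1,\dots,x_n-a_n$. Conjugacy and centralizers: $\mathcal{D}_{\mathbf{a}}(\beta)=\sigma(\beta)\mathbf{a}+\delta(\beta)\in\mathbb{F}^n$ for $\beta\in\mathbb{F}$; $\mathbf{a}^\beta=\mathcal{D}_{\mathbf{a}}(\beta)\beta^{-1}$ for $\beta\in\mathbb{F}^*$; $\mathcal{C}(\mathbf{a})=\{\mathbf{a}^\beta\mid\beta\in\mathbb{F}^*\}$ is the conjugacy class of $\mathbf{a}$ (conjugacy is an equivalence relation on $\mathbb{F}^n$);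 $K_{\mathbf{a}}=\{\beta\in\mathbb{F}\mid\mathcal{D}_{\mathbf{a}}(\beta)=\mathbf{a}\beta\}$ is the centralizer of $\mathbf{a}$, a division subring of $\mathbb{F}$. P-closed sets: for $\Omega\subseteq\mathbb{F}^n$, $I(\Omega)=\{F\mid F(\mathbf{a})=0\ \forall\mathbf{a}\in\Omega\}$; for a set $\mathcal{A}$ of skew polynomials, $Z(\mathcal{A})=\{\mathbf{a}\in\mathbb{F}^n\mid F(\mathbf{a})=0\ \forall F\in\mathcal{A}\}$. The P-closure is $\overline{\Omega}=Z(I(\Omega))$, and $\Omega$ is P-closed if $\overline{\Omega}=\Omega$. A P-closed $\Omega$ is generated by $\mathcal{G}\subseteq\Omega$ if $\overline{\mathcal{G}}=\Omega$, and is finitely generated if some finite $\mathcal{G}$ generates it. A set $\Omega$ is P-independent if $\mathbf{a}\notin\overline{\Omega\setminus\{\mathbf{a}\}}$ for all $\mathbf{a}\in\Omega$. A P-basis of a P-closed set is a P-independent generating subset. All P-bases of a finitely generated P-closed set $\Omega$ are finite of the same size, which is called its rank $\mathrm{Rk}(\Omega)$. The sum of two finitely generated P-closed sets is $\Omega_1+\Omega_2=\overline{\Omega_1\cup\Omega_2}$. Projective spaces: for a division subring $K\subseteq\mathbb{F}$, $\mathbb{P}^R_K(\mathbb{F})=\{[\beta]\mid\beta\in\mathbb{F}^*\}$ with $[\beta]=\{\beta\lambda\mid\lambda\in K^*\}$. Its finite-dimensional right $K$-linear projective subspaces are the sets $\{[\beta]\mid\beta\in V\setminus\{0\}\}$ for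 finite-dimensional right $K$-subspaces $V\subseteq\mathbb{F}$ (including $V=\{0\}$), forming a lattice under intersection and sum, where these correspond to intersection and sum of the subspaces $V$. *)

(* Defs.v *)
From HB Require Import structures.
From mathcomp Require Import all_boot all_algebra finmap all_classical.
From mathcomp.multinomials Require Import monalg.

Set Implicit Arguments.
Unset Strict Implicit.
Unset Printing Implicit Defensive.

Import GRing.Theory.

Local Open Scope card_scope.
Local Open Scope classical_set_scope.
Local Open Scope ring_scope.

(* Multiplication is not assumed to commute. *)
Definition division_ring (F : unitRingType) : Prop :=
  forall x : F, x != 0 -> x \is a GRing.unit.

(* In [v *m b%:M] below, [b%:M] is 1 x 1, so that the product is the column  *)
(* [v] with each entry multiplied by [b] on the right.                       *)
Record skew_derivation (F : unitRingType) (n : nat)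
    (sigma : {rmorphism F -> 'M[F]_n}) := SkewDerivation {
  sder_fun :> F -> 'cV[F]_n;
  sderD : forall a b, sder_fun (a + b) = sder_fun a + sder_fun b;
  sderM : forall a b,
    sder_fun (a * b) = sigma a *m sder_fun b + sder_fun a *m b%:M
}.

Lemma col_scaleE (F : unitRingType) (n : nat) (v : 'cV[F]_n) (b : F) i :
  (v *m b%:M) i 0 = v i 0 * b.
Proof. by rewrite mxE big_ord1 [b%:M _ _]mxE eqxx mulr1n. Qed.

Definition left_ideal_gen (R : nzRingType) (m : nat) (g : 'I_m -> R) : set R :=
  [set x | exists h : 'I_m -> R, x = \sum_(i < m) h i * g i].

Section MsuppSum.
Variables (F : nzRingType) (K : choiceType) (V : zmodType) (f : K -> F -> V).
Hypothesis fD : forall w a b, f w (a + b) = f w a + f w b.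

Let f0 w : f w 0 = 0.
Proof. by apply: (addrI (f w 0)); rewrite -fD !addr0. Qed.

Lemma msupp_sumEw (d : {fset K}) (G : {malg F[K]}) : (msupp G `<=` d)%fset ->
  \sum_(w <- msupp G) f w G@_w = \sum_(w <- d) f w G@_w.
Proof.
by move=> le; apply: big_fset_incl => // w _ /mcoeff_outdom ->.
Qed.

Lemma msupp_sumD (G H : {malg F[K]}) :
  \sum_(w <- msupp (G + H)) f w (G + H)@_w =
  \sum_(w <- msupp G) f w G@_w + \sum_(w <- msupp H) f w H@_w.
Proof.
pose d := (msupp G `|` msupp H)%fset.
rewrite (@msupp_sumEw d (G + H)) ?msuppD_le //.
rewrite (@msupp_sumEw d G) ?fsubsetUl // (@msupp_sumEw d H) ?fsubsetUr //.
by rewrite -big_split; apply: eq_bigr => w _; rewrite mcoeffD fD.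
Qed.

Lemma msupp_sum0 : \sum_(w <- msupp (0 : {malg F[K]})) f w 0@_w = 0.
Proof. by rewrite msupp0 big_seq_fset0. Qed.

Lemma msupp_sumU w c :
  \sum_(v <- msupp (<< c *g w >> : {malg F[K]})) f v << c *g w >>@_v = f w c.
Proof. by rewrite (msupp_sumEw msuppU_le) big_seq_fset1 mcoeffUU. Qed.

End MsuppSum.

Section SkewPolynomialRing.
Variables (F : unitRingType) (n : nat) (sigma : {rmorphism F -> 'M[F]_n}).
Variable (delta : skew_derivation sigma).

(* The left module over F with basis the words in the letters 0, ..., n - 1, *)
(* under an alias, so that it can carry the twisted product. The ring below  *)
(* depends on sigma through the type of delta : skew_derivation sigma.       *)
Definition skewpoly (_ : F -> 'cV[F]_n) : Type := {malg F[seq 'I_n]}.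

HB.instance Definition _ := GRing.Lmodule.on (skewpoly delta).

Notation S := (skewpoly delta).
Implicit Types (P Q G H : S) (w : seq 'I_n) (i : 'I_n).

(* x_i (c m) = \sum_j sigma_ij(c) x_j m + delta_i(c) m, for each term c m. *)
Definition skew_mulX i G : S :=
  \sum_(w <- msupp G)
    (\sum_(j < n) << sigma G@_w i j *g j :: w >> + << delta G@_w i 0 *g w >>).

Definition skew_mulw w G : S := foldr skew_mulX G w.

Definition skew_mul P Q : S :=
  \sum_(w <- msupp P) P@_w *: skew_mulw w Q.

Definition skew_one : S := << [::] >>.

Let fX i (w : seq 'I_n) (c : F) : S :=
  \sum_(j < n) << sigma c i j *g j :: w >> + << delta c i 0 *g w >>.

Let fXD i w a b : fX i w (a + b) = fX i w a + fX i w b.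
Proof.
rewrite /fX rmorphD sderD !mxE addrACA monalgUD -big_split; congr (_ + _).
by apply: eq_bigr => j _; rewrite mxE monalgUD.
Qed.

Let skew_mulXD i G H : skew_mulX i (G + H) = skew_mulX i G + skew_mulX i H.
Proof. exact: (msupp_sumD (fXD i)). Qed.

Let skew_mulX0 i : skew_mulX i 0 = 0.
Proof. exact: (@msupp_sum0 _ _ S (fX i)). Qed.

Let skew_mulXU i w c : skew_mulX i << c *g w >> = fX i w c.
Proof. exact: (msupp_sumU (fXD i)). Qed.

Let skew_mulwD w G H : skew_mulw w (G + H) = skew_mulw w G + skew_mulw w H.
Proof. by elim: w => //= i w ->; rewrite skew_mulXD. Qed.

Let skew_mulw0 w : skew_mulw w 0 = 0.
Proof. by elim: w => //= i w ->; rewrite skew_mulX0. Qed.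

Let ZU (a c : F) w : a *: (<< c *g w >> : S) = << a * c *g w >>.
Proof.
by apply/malgP => v; rewrite mcoeffZ !mcoeffU mulrnAr.
Qed.

Let ind (A : S -> Prop) : A 0 -> (forall c w, A << c *g w >>) ->
  (forall G H, A G -> A H -> A (G + H)) -> forall G, A G.
Proof.
move=> A0 AU AD G; rewrite (monalgE G).
by apply: (big_ind A) => // w _; apply: AU.
Qed.

Let skew_mulDl : left_distributive skew_mul +%R.
Proof.
move=> P Q G; apply: (msupp_sumD (f := fun w c => c *: skew_mulw w G)).
by move=> w a b; rewrite scalerDl.
Qed.

Let skew_mulDr : right_distributive skew_mul +%R.
Proof.
move=> P Q G; rewrite /skew_mul -big_split; apply: eq_bigr => w _ /=.
by rewrite skew_mulwD scalerDr.
Qed.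

Let skew_mulU c w G : skew_mul << c *g w >> G = c *: skew_mulw w G.
Proof.
apply: (msupp_sumU (f := fun w c => c *: skew_mulw w G)).
by move=> v a b; rewrite scalerDl.
Qed.

Let skew_mul0l G : skew_mul 0 G = 0.
Proof. by rewrite /skew_mul msupp0 big_seq_fset0. Qed.

Let skew_mul0r G : skew_mul G 0 = 0.
Proof. by rewrite /skew_mul big1 // => w _; rewrite skew_mulw0 scaler0. Qed.

Let skew_mul_suml I (r : seq I) (f : I -> S) G :
  skew_mul (\sum_(k <- r) f k) G = \sum_(k <- r) skew_mul (f k) G.
Proof.
exact: (big_morph (fun P => skew_mul P G) (fun P Q => skew_mulDl P Q G)
  (skew_mul0l G)).
Qed.

Let skew_mulXZ i c G : skew_mulX i (c *: G) =
  \sum_(j < n) sigma c i j *: skew_mulX j G + delta c i 0 *: G.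
Proof.
elim/ind: G => [|d w|G H IG IH].
- rewrite !scaler0 skew_mulX0 big1 ?addr0 // => j _.
  by rewrite skew_mulX0 scaler0.
- rewrite !ZU skew_mulXU /fX rmorphM sderM mxE monalgUD addrA.
  rewrite col_scaleE.
  congr (_ + _).
  under [RHS]eq_bigr do rewrite skew_mulXU /fX scalerDr scaler_sumr ZU.
  rewrite big_split /= mxE raddf_sum /=; congr (_ + _).
  rewrite exchange_big /=; apply: eq_bigr => j _.
  by rewrite mxE raddf_sum; apply: eq_bigr => k _; rewrite ZU.
- rewrite [c *: _]scalerDr [LHS]skew_mulXD IG IH [LHS]addrACA.
  rewrite [X in _ = _ + X]scalerDr; congr (_ + _).
  rewrite -[LHS]big_split; apply: eq_bigr => j _.
  by rewrite -[LHS]scalerDr -skew_mulXD.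
Qed.

Let skew_mulXA i P Q : skew_mul (skew_mulX i P) Q = skew_mulX i (skew_mul P Q).
Proof.
elim/ind: P => [|d w|G H IG IH].
- by rewrite skew_mulX0 skew_mul0l skew_mulX0.
- rewrite skew_mulXU skew_mulDl skew_mul_suml !skew_mulU skew_mulXZ.
  by congr (_ + _); apply: eq_bigr => j _; rewrite skew_mulU.
- by rewrite skew_mulXD !skew_mulDl skew_mulXD IG IH.
Qed.

Let skew_mulwA w P Q : skew_mul (skew_mulw w P) Q = skew_mulw w (skew_mul P Q).
Proof. by elim: w => //= i w <-; rewrite skew_mulXA. Qed.

Lemma skew_mulZl c P Q : c *: skew_mul P Q = skew_mul (c *: P) Q.
Proof.
elim/ind: P => [|d w|G H IG IH].
- by rewrite scaler0 !skew_mul0l scaler0.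
- by rewrite ZU !skew_mulU scalerA.
- by rewrite scalerDr !skew_mulDl scalerDr IG IH.
Qed.

Let skew_mulA : associative skew_mul.
Proof.
move=> P Q R; elim/ind: P => [|d w|G H IG IH].
- by rewrite !skew_mul0l.
- by rewrite !skew_mulU -skew_mulZl skew_mulwA.
- by rewrite !skew_mulDl IG IH.
Qed.

Let skew_mul1l : left_id skew_one skew_mul.
Proof. by move=> P; rewrite skew_mulU scale1r. Qed.

Let sder1 : delta 1 = 0.
Proof.
apply: (addrI (delta 1)); rewrite addr0 -{3}(mulr1 1) sderM rmorph1.
by rewrite mul1mx mulmx1.
Qed.

Let skew_mulw1 w : skew_mulw w skew_one = << w >>.
Proof.
elim: w => //= i w ->; rewrite skew_mulXU /fX sder1 mxE monalgU0 addr0.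
rewrite rmorph1 (bigD1 i) //= mxE eqxx big1 ?addr0 // => j ji.
by rewrite mxE eq_sym (negPf ji) monalgU0.
Qed.

Let skew_mul1r : right_id skew_one skew_mul.
Proof.
elim/ind => [|d w|G H IG IH].
- by rewrite skew_mul0l.
- by rewrite skew_mulU skew_mulw1 ZU mulr1.
- by rewrite skew_mulDl IG IH.
Qed.

Let skew_one_neq0 : skew_one != 0.
Proof. by rewrite monalgU_eq0 oner_neq0. Qed.

HB.instance Definition _ := GRing.Zmodule_isNzRing.Build S
  skew_mulA skew_mul1l skew_mul1r skew_mulDl skew_mulDr skew_one_neq0.

HB.instance Definition _ := GRing.Lmodule_isLalgebra.Build F S skew_mulZl.

Definition skew_word w : S := << w >>.
Definition skew_var i : S := skew_word [:: i].

Lemma skew_word_cat w1 w2 : skew_word w1 * skew_word w2 = skew_word (w1 ++ w2).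
Proof.
rewrite /skew_word /GRing.mul /= skew_mulU scale1r -skew_mulw1.
by rewrite -[RHS]skew_mulw1 /skew_mulw foldr_cat.
Qed.

Lemma skew_wordE P : P = \sum_(w <- msupp P) P@_w *: skew_word w.
Proof.
by rewrite {1}[P]monalgE; apply: eq_bigr => w _; rewrite ZU mulr1.
Qed.

Lemma skew_varM i P : skew_var i * P = skew_mulX i P.
Proof. by rewrite /GRing.mul /= skew_mulU scale1r. Qed.

Lemma skew_varZ i a : skew_var i * a%:A =
  \sum_(j < n) sigma a i j *: skew_var j + (delta a i 0)%:A.
Proof.
have E j : skew_mulX j skew_one = skew_var j.
  by rewrite -[LHS]/(skew_mulw [:: j] _) skew_mulw1.
rewrite [LHS]skew_varM [LHS](skew_mulXZ i a skew_one).
by under eq_bigr do rewrite E.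
Qed.

(* The element c is unique: see skew_eval_unique and skew_evalP. *)
Definition skew_eval P (a : 'cV[F]_n) : F :=
  xget 0 [set c : F |
    left_ideal_gen (fun i => skew_var i - (a i 0)%:A) (P - c%:A)].

Definition conj_map (a : 'cV[F]_n) (b : F) : 'cV[F]_n :=
  sigma b *m a + delta b.

Section EvalTheory.
Variable a : 'cV[F]_n.

Let J : set S := left_ideal_gen (fun i => skew_var i - (a i 0)%:A).

Let act_word (w : seq 'I_n) (b : F) : F :=
  foldr (fun i c => conj_map a c i 0) b w.

Let act P (b : F) : F := \sum_(w <- msupp P) P@_w * act_word w b.

Let conj_mapD b c : conj_map a (b + c) = conj_map a b + conj_map a c.
Proof. by rewrite /conj_map rmorphD mulmxDl sderD addrACA. Qed.

Let conj_map0 : conj_map a 0 = 0.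
Proof. by apply: (addrI (conj_map a 0)); rewrite -conj_mapD !addr0. Qed.

Let act_word0 w : act_word w 0 = 0.
Proof. by elim: w => //= i w ->; rewrite conj_map0 mxE. Qed.

Let act_wordD w b c : act_word w (b + c) = act_word w b + act_word w c.
Proof. by elim: w => //= i w ->; rewrite conj_mapD mxE. Qed.

Let actD P Q b : act (P + Q) b = act P b + act Q b.
Proof.
apply: (msupp_sumD (f := fun w c => c * act_word w b)) => w c d.
by rewrite mulrDl.
Qed.

Let actU c w b : act << c *g w >> b = c * act_word w b.
Proof.
apply: (msupp_sumU (f := fun w c => c * act_word w b)) => v d e.
by rewrite mulrDl.
Qed.

Let act0 b : act 0 b = 0.
Proof. by rewrite /act msupp0 big_seq_fset0. Qed.

Let act0r P : act P 0 = 0.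
Proof. by rewrite /act big1 // => w _; rewrite act_word0 mulr0. Qed.

Let act_sum I (r : seq I) (f : I -> S) b :
  act (\sum_(k <- r) f k) b = \sum_(k <- r) act (f k) b.
Proof. exact: (big_morph (act^~ b) (fun P Q => actD P Q b) (act0 b)). Qed.

Let actN P b : act (- P) b = - act P b.
Proof. by apply: (addrI (act P b)); rewrite -actD !subrr act0. Qed.

Let act_Z c P b : act (c *: P) b = c * act P b.
Proof.
elim/ind: P => [|d w|G H IG IH].
- by rewrite scaler0 act0 mulr0.
- by rewrite ZU !actU mulrA.
- by rewrite scalerDr !actD mulrDr IG IH.
Qed.

Let conj_mapM c b i :
  conj_map a (c * b) i 0 =
  \sum_(j < n) sigma c i j * conj_map a b j 0 + delta c i 0 * b.
Proof.
rewrite /conj_map rmorphM sderM -mulmxA addrA -mulmxDr mxE col_scaleE.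
by rewrite mxE.
Qed.

Let act_varM i P b : act (skew_var i * P) b = conj_map a (act P b) i 0.
Proof.
rewrite skew_varM; elim/ind: P => [|d w|G H IG IH].
- by rewrite skew_mulX0 act0 conj_map0 mxE.
- rewrite skew_mulXU actD act_sum !actU conj_mapM; congr (_ + _).
  by apply: eq_bigr => j _; rewrite actU.
- by rewrite skew_mulXD !actD conj_mapD mxE IG IH.
Qed.

Let skew_word_cons i w : skew_word (i :: w) = skew_var i * skew_word w.
Proof. by rewrite skew_word_cat. Qed.

Let act_M P Q b : act (P * Q) b = act P (act Q b).
Proof.
rewrite [P]skew_wordE mulr_suml !act_sum; apply: eq_bigr => w _.
rewrite -scalerAl !act_Z; congr (_ * _).
elim: w => [|i w IH]; last by rewrite skew_word_cons -mulrA !act_varM IH.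
by rewrite mul1r actU mul1r.
Qed.

Let act_C c b : act c%:A b = c * b.
Proof. by rewrite act_Z actU mul1r. Qed.

Let act_gen i : act (skew_var i - (a i 0)%:A) 1 = 0.
Proof.
rewrite actD actN act_C mulr1 -[skew_var i]mulr1 act_varM.
rewrite actU mul1r /conj_map sder1 rmorph1 mul1mx addr0.
by rewrite subrr.
Qed.

Let act_J P : J P -> act P 1 = 0.
Proof.
by case=> h ->; rewrite act_sum big1 // => i _; rewrite act_M act_gen act0r.
Qed.

Let JD P Q : J P -> J Q -> J (P + Q).
Proof.
move=> [g ->] [h ->]; exists (fun i => g i + h i).
by rewrite -big_split; apply: eq_bigr => i _; rewrite mulrDl.
Qed.

Let JM P Q : J Q -> J (P * Q).
Proof.
move=> [g ->]; exists (fun i => P * g i).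
by rewrite mulr_sumr; apply: eq_bigr => i _; rewrite mulrA.
Qed.

Let J0 : J 0.
Proof. by exists (fun=> 0); rewrite big1 // => i _; rewrite mul0r. Qed.

Let Jgen i : J (skew_var i - (a i 0)%:A).
Proof.
exists (fun j => (i == j)%:R); rewrite (bigD1 i) //= eqxx mul1r big1 ?addr0 //.
by move=> j /negPf; rewrite eq_sym => ->; rewrite mul0r.
Qed.

Let J_sum I (r : seq I) (f : I -> S) :
  (forall k, J (f k)) -> J (\sum_(k <- r) f k).
Proof.
move=> Jf; elim: r => [|k r IH]; first by rewrite big_nil.
by rewrite big_cons; apply: JD.
Qed.

Let JZ c P : J P -> J (c *: P).
Proof. by move=> JP; rewrite -[P]mul1r scalerAl; apply: JM. Qed.

Let aux (V : zmodType) (x y z t : V) : x - (t + z) = x - (y + z) + (y - t).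
Proof. by rewrite !opprD !addrA [_ - _ - _ + _]addrAC subrK addrAC. Qed.

Let J_word w : J (skew_word w - (act_word w 1)%:A).
Proof.
elim: w => [|i w IH] /=.
  by rewrite scale1r subrr; apply: J0.
set c := act_word w 1 in IH *.
pose X : S := \sum_(j < n) sigma c i j *: skew_var j.
pose d : S := (delta c i 0)%:A.
pose e := \sum_(j < n) sigma c i j * a j 0.
have E1 : (conj_map a c i 0)%:A = e%:A + d :> S.
  by rewrite /conj_map mxE [(sigma c *m a) i 0]mxE scalerDl.
have E2 : skew_var i * (skew_word w - c%:A) = skew_word (i :: w) - (X + d).
  by rewrite mulrBr (skew_varZ i c) skew_word_cons.
have E3 : \sum_(j < n) sigma c i j *: (skew_var j - (a j 0)%:A) = X - e%:A.
  rewrite /e scaler_suml -sumrB; apply: eq_bigr => j _.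
  by rewrite scalerBr scalerA.
have := aux (skew_word (i :: w)) X d e%:A; rewrite -E1 -E2 -E3 => ->.
apply: JD; first exact: JM.
by apply: J_sum => j; apply: JZ (Jgen j).
Qed.

Let J_act P : J (P - (act P 1)%:A).
Proof.
rewrite {1}[P]skew_wordE /act scaler_suml -sumrB.
apply: J_sum => w.
by rewrite -scalerA -scalerBr; apply: JZ.
Qed.

Lemma skew_eval_unique P :
  exists! c : F, left_ideal_gen (fun i => skew_var i - (a i 0)%:A) (P - c%:A).
Proof.
exists (act P 1); split; first exact: J_act.
move=> c /act_J; rewrite actD actN act_C mulr1 => /eqP.
by rewrite subr_eq0 => /eqP.
Qed.

Lemma skew_evalP P :
  left_ideal_gen (fun i => skew_var i - (a i 0)%:A) (P - (skew_eval P a)%:A).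
Proof.
have [c [Jc _]] := skew_eval_unique P.
exact: (@xgetI _ 0 [set c : F | J (P - c%:A)] c Jc).
Qed.

End EvalTheory.

End SkewPolynomialRing.

Section PClosedSets.
Variables (F : unitRingType) (n : nat) (sigma : {rmorphism F -> 'M[F]_n}).
Variable (delta : skew_derivation sigma).
Implicit Types (X Y B G : set 'cV[F]_n) (a : 'cV[F]_n).

Definition conj_by a (b : F) : 'cV[F]_n := conj_map delta a b *m (b^-1)%:M.

Definition conj_class a : set 'cV[F]_n :=
  [set conj_by a b | b in [set b : F | b != 0]].

Definition centralizer a : set F := [set b | conj_map delta a b = a *m b%:M].

Definition vanishing_ideal X : set (skewpoly delta) :=
  [set P | forall a, X a -> skew_eval P a = 0].

Definition zero_set (A : set (skewpoly delta)) : set 'cV[F]_n :=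
  [set a | forall P, A P -> skew_eval P a = 0].

Definition pclosure X : set 'cV[F]_n := zero_set (vanishing_ideal X).

Definition pclosed X : Prop := pclosure X = X.

Definition pgenerated X G : Prop := G `<=` X /\ pclosure G = X.

Definition fg_pclosed X : Prop :=
  pclosed X /\ exists2 G, finite_set G & pgenerated X G.

Definition pindependent B : Prop :=
  forall a, B a -> ~ pclosure (B `\ a) a.

Definition pbasis X B : Prop := pgenerated X B /\ pindependent B.

(* 0 by convention if X has no finite P-basis. *)
Definition prank X : nat :=
  xget 0%N [set k | exists2 B, pbasis X B & B #= `I_k].

Definition psum X Y : set 'cV[F]_n := pclosure (X `|` Y).

End PClosedSets.

(* The ambient F is a right K-module, for a division subring K of F. *)
Section RightProjectiveSpace.
Variables (F : unitRingType) (K : set F).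
Implicit Types (V : set F) (L M : set (set F)).

Definition right_comb m (b l : 'I_m -> F) : F := \sum_(i < m) b i * l i.

Definition right_span m (b : 'I_m -> F) : set F :=
  [set right_comb b l | l in [set l | forall i, K (l i)]].

Definition right_free m (b : 'I_m -> F) : Prop :=
  forall l, (forall i, K (l i)) -> right_comb b l = 0 -> forall i, l i = 0.

Definition fin_dim_subspace V : Prop :=
  exists m (b : 'I_m -> F), right_free b /\ right_span b = V.

Definition proj_point (b : F) : set F :=
  [set b * l | l in [set l | K l /\ l != 0]].

Definition proj_of V : set (set F) := [set proj_point b | b in V `\ 0].

Definition fin_dim_proj_subspace L : Prop :=
  exists2 V, fin_dim_subspace V & L = proj_of V.

(* The subspace V such that L = proj_of V. *)
Definition subspace_of L : set F := 0 |` \bigcup_(p in L) p.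

Definition proj_sum L M : set (set F) :=
  proj_of [set x + y | x in subspace_of L & y in subspace_of M].

End RightProjectiveSpace.

(* A collection C closed under two operations of the ambient type that make *)
(* it a lattice; when meet is the intersection of sets, the lattice order is *)
(* inclusion.                                                                *)
Definition is_lattice (T : Type) (C : set T) (join meet : T -> T -> T) : Prop :=
  [/\ forall x y, C x -> C y -> C (join x y) /\ C (meet x y),
      forall x y, C x -> C y -> join x y = join y x /\ meet x y = meet y x,
      forall x y z, C x -> C y -> C z ->
        join x (join y z) = join (join x y) z /\
        meet x (meet y z) = meet (meet x y) z
    & forall x y, C x -> C y ->
        join x (meet x y) = x /\ meet x (join x y) = x].

Definition lattice_isomorphic
    (T : Type) (C : set T) (joinC meetC : T -> T -> T)
    (U : Type) (D : set U) (joinD meetD : U -> U -> U) : Prop :=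
  exists f : T -> U,
    [/\ set_bij C D f,
        forall x y, C x -> C y -> f (joinC x y) = joinD (f x) (f y)
      & forall x y, C x -> C y -> f (meetC x y) = meetD (f x) (f y)].

Definition pointwise (I T : Type) (op : I -> T -> T -> T) (x y : I -> T) :=
  fun i => op i (x i) (y i).

(* Main.v *)
(* Evaluation at a point [c] is a left-linear functional on skew polynomials *)
(* and P-dependence is right-linear dependence of these functionals: for a   *)
(* P-independent finite [s] with dual polynomials [p_d], a point [c] of its  *)
(* P-closure satisfies [P(c) = \sum_(d in s) P(d) mu_d] with                 *)
(* [mu_d = p_d(c)]. Taking [P = x_i p_d] and using the product rule gives    *)
(* [sigma(mu_d) c + delta(mu_d) = d mu_d], so that [d] is conjugate to [c]   *)
(* whenever [mu_d != 0]. Hence P-closures split along conjugacy classes.     *)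
(* Inside the class of [a], the elements [b] whose conjugate [a^b] lies in a *)
(* P-closed [X] are the [b] killed by [b |-> (P b)(a)] for all [P] in        *)
(* [I(X)]; these maps are right linear over the centralizer of [a], and      *)
(* [b = \sum_d mu_d b] with [c = a^b] expresses [b] in terms of generators   *)
(* of [X], which yields the lattice isomorphism.                             *)

Require Import Defs.
From HB Require Import structures.
From mathcomp Require Import all_boot all_algebra finmap all_classical.
From mathcomp.multinomials Require Import monalg.

Import GRing.Theory.

Local Open Scope classical_set_scope.
Local Open Scope ring_scope.

(** The engine is the product rule [skew_eval_link], which trades evaluation at a conjugate of [a]
    for evaluation at [a] itself. Together with dual polynomials it yields [pclosure_expansion]:
    points of the closure of a finite set are those admitting weights of sum 1, each weight linking
    the point to a point of that set. A nonzero weight is a conjugacy, hence [pclosure_conj]: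
    closure commutes with cutting down to one class. Closures, bases and ranks of a union over
    distinct classes can thus be computed class by class.

    Finite generation and rank rest on the exchange bound [size_independent], which also gives
    [fg_pclosedS] and so finite generation of intersections.

    For the lattice, a point [c] in the class of [a] determines its conjugator up to a right factor
    in the centralizer, so the part of [X] in that class is the projective space of
    [conj_space a X]. By [conj_space_min] this space is spanned by conjugators of the generators of
    [X], which gives finite dimension, compatibility with sums and surjectivity. *)

(** * Skew evaluation, the product rule and links between conjugate points *)

Section SkewEvaluation.
Context {F : unitRingType} {n : nat} {sigma : {rmorphism F -> 'M[F]_n}}.
Context {delta : skew_derivation sigma}.
Implicit Types (P Q : skewpoly delta) (a c d : 'cV[F]_n) (b : F).

Lemma skew_evalE P a b :
  left_ideal_gen (fun i => skew_var delta i - (a i 0)%:A) (P - b%:A) ->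
  skew_eval P a = b.
Proof.
move=> Pb; have [c [_ cU]] := skew_eval_unique a P.
by rewrite -(cU _ Pb) -(cU _ (skew_evalP a P)).
Qed.

Lemma skew_evalD P Q a : skew_eval (P + Q) a = skew_eval P a + skew_eval Q a.
Proof.
apply: skew_evalE.
have [g gE] := skew_evalP a P; have [h hE] := skew_evalP a Q.
exists (fun i => g i + h i).
rewrite scalerDl opprD addrACA gE hE -big_split.
by apply: eq_bigr => i _; rewrite mulrDl.
Qed.

(** Multiplying [Q - Q(a)] by [P] on the left stays inside the left ideal. *)
Lemma skew_evalM P Q a :
  skew_eval (P * Q) a = skew_eval (P * (skew_eval Q a)%:A) a.
Proof.
apply: skew_evalE; set R := P * _%:A.
have [g gE] := skew_evalP a R; have [h hE] := skew_evalP a Q.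
exists (fun i => g i + P * h i).
rewrite -[P * Q](subrK R) -addrA gE -mulrBr hE mulr_sumr addrC -big_split.
by apply: eq_bigr => i _; rewrite mulrDl mulrA.
Qed.

Lemma skew_evalC b a : skew_eval (b%:A : skewpoly delta) a = b.
Proof.
apply: skew_evalE; exists (fun=> 0).
by rewrite subrr big1 // => i _; rewrite mul0r.
Qed.

Lemma skew_evalZ b P a : skew_eval (b *: P) a = b * skew_eval P a.
Proof.
apply: skew_evalE; have [h hE] := skew_evalP a P.
exists (fun i => b *: h i).
rewrite -scalerA -scalerBr hE scaler_sumr.
by apply: eq_bigr => i _; rewrite scalerAl.
Qed.

Lemma skew_eval0 a : skew_eval (0 : skewpoly delta) a = 0.
Proof. by rewrite -(scale0r (0 : skewpoly delta)) skew_evalZ mul0r. Qed.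

Lemma skew_evalB P Q a : skew_eval (P - Q) a = skew_eval P a - skew_eval Q a.
Proof. by rewrite skew_evalD -scaleN1r skew_evalZ mulN1r. Qed.

Lemma skew_eval_sum I (r : seq I) (f : I -> skewpoly delta) a :
  skew_eval (\sum_(k <- r) f k) a = \sum_(k <- r) skew_eval (f k) a.
Proof.
exact: (big_morph _ (fun P Q => skew_evalD P Q a) (skew_eval0 a)).
Qed.

Lemma skew_eval_var i a : skew_eval (skew_var delta i) a = a i 0.
Proof.
apply: skew_evalE; exists (fun j => (i == j)%:R).
rewrite (bigD1 i) //= eqxx mul1r big1 ?addr0 // => j /negPf.
by rewrite eq_sym => ->; rewrite mul0r.
Qed.

Lemma skew_eval_varC i a b :
  skew_eval (skew_var delta i * b%:A) a = conj_map delta a b i 0.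
Proof.
rewrite skew_varZ skew_evalD skew_evalC skew_eval_sum /conj_map !mxE.
by congr (_ + _); apply: eq_bigr => j _; rewrite skew_evalZ skew_eval_var.
Qed.

(* For [b != 0] this says that [c] is the conjugate of [a] by [b]; for       *)
(* [c = a] it says that [b] centralizes [a].                                 *)
Definition conj_link a b c := conj_map delta a b = c *m b%:M.

(* The product rule [(P b)(a) = P(a^b) b]. *)
Lemma skew_eval_link {a b c} P : conj_link a b c ->
  skew_eval (P * b%:A) a = skew_eval P c * b.
Proof.
move=> abc; have [h hE] := skew_evalP c P.
rewrite -[P in LHS](subrK (skew_eval P c)%:A) hE mulrDl mulr_suml skew_evalD.
rewrite -scalerAl mul1r scalerA skew_evalC skew_eval_sum big1 ?add0r // => i _.
(* By [abc], both terms of [(x_i - c_i) b] evaluate to [c_i b] at [a], so every left multiple of it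
   vanishes there. *)
rewrite -mulrA skew_evalM mulrBl skew_evalB skew_eval_varC abc col_scaleE.
by rewrite -scalerAl mul1r scalerA skew_evalC subrr scale0r mulr0 skew_eval0.
Qed.

Lemma conj_link1 a : conj_link a 1 a.
Proof.
apply/matrixP => i j; rewrite ord1 -skew_eval_varC scale1r mulr1.
by rewrite skew_eval_var col_scaleE mulr1.
Qed.

Lemma conj_link0 a c : conj_link a 0 c.
Proof.
apply/matrixP => i j; rewrite ord1 -skew_eval_varC scale0r mulr0.
by rewrite skew_eval0 col_scaleE mulr0.
Qed.

Lemma conj_linkD {a b b' c} :
  conj_link a b c -> conj_link a b' c -> conj_link a (b + b') c.
Proof.
move=> ab ab'; rewrite /conj_link /conj_map rmorphD sderD mulmxDl addrACA.
by rewrite raddfD mulmxDr -ab -ab'.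
Qed.

(** Two uses of evaluation: [x_i b' b] at [a] is [x_i b'] at [c] times [b], that is [d_i b' b]. *)
Lemma conj_linkM {a b c b' d} :
  conj_link a b c -> conj_link c b' d -> conj_link a (b' * b) d.
Proof.
move=> abc cbd; apply/matrixP => i j; rewrite ord1 -skew_eval_varC.
rewrite -scalerA -[b%:A in X in _ *: X]mul1r scalerAl mulrA.
by rewrite (skew_eval_link _ abc) skew_eval_varC cbd !col_scaleE mulrA.
Qed.

Lemma conj_linkV {a b c} : b \is a GRing.unit ->
  conj_link a b c -> conj_link c b^-1 a.
Proof.
move=> bU abc; apply/matrixP => i j; rewrite ord1 -skew_eval_varC.
apply: (mulIr bU); rewrite -(skew_eval_link _ abc) -mulrA -scalerAl mul1r.
rewrite scalerA mulVr // scale1r mulr1 skew_eval_var.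
by rewrite col_scaleE -mulrA mulVr // mulr1.
Qed.

End SkewEvaluation.

Arguments conj_link {F n sigma} delta a b c.

(** * P-closure, P-independence and rank *)

Section PClosure.
Context {F : unitRingType} (divF : division_ring F).
Context {n : nat} {sigma : {rmorphism F -> 'M[F]_n}}.
Context {delta : skew_derivation sigma}.
Implicit Types (P Q : skewpoly delta) (a c d : 'cV[F]_n) (b : F).
Implicit Types (X Y : set 'cV[F]_n) (s t : seq 'cV[F]_n).

Local Notation cl := (pclosure delta).
Local Notation I := (vanishing_ideal (delta := delta)).

Lemma sub_pclosure X : X `<=` cl X.
Proof. by move=> a Xa P; apply. Qed.

Lemma pclosureS X Y : X `<=` Y -> cl X `<=` cl Y.
Proof. by move=> XY a Xa P YP; apply: Xa => c /XY /YP. Qed.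

Lemma vanishing_pclosure X : I (cl X) = I X.
Proof.
apply/seteqP; split=> P PX a; first by move/sub_pclosure/PX.
by move=> /(_ P PX).
Qed.

Lemma pclosureK X : cl (cl X) = cl X.
Proof. by rewrite {1}/pclosure vanishing_pclosure. Qed.

Lemma pclosure_min X Y : X `<=` cl Y -> cl X `<=` cl Y.
Proof. by move=> /pclosureS; rewrite pclosureK. Qed.

Lemma pclosureUl X Y : cl (cl X `|` Y) = cl (X `|` Y).
Proof.
apply/seteqP; split; last first.
  by apply: pclosureS; apply: setSU; exact: sub_pclosure.
apply: pclosure_min => a [|Ya]; last by apply: sub_pclosure; right.
by apply: pclosureS => c Xc; left.
Qed.

Lemma pclosureUr X Y : cl (X `|` cl Y) = cl (X `|` Y).
Proof. by rewrite setUC pclosureUl setUC. Qed.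

Lemma pclosedI X Y : pclosed delta X -> pclosed delta Y ->
  pclosed delta (X `&` Y).
Proof.
move=> clX clY; apply/seteqP; split; last exact: sub_pclosure.
move=> a aXY; split; [rewrite -clX | rewrite -clY];
  by apply: pclosureS aXY => c [].
Qed.

Lemma notin_pclosureP {X a} :
  ~ cl X a <-> exists2 P, I X P & skew_eval P a = 1.
Proof.
split=> [/existsNP[P /not_implyP[XP /eqP Pa]]|[P XP Pa] /(_ _ XP)].
  exists ((skew_eval P a)^-1 *: P).
    by move=> c /XP Pc; rewrite skew_evalZ Pc mulr0.
  by rewrite skew_evalZ mulVr ?divF.
by rewrite Pa => /eqP; rewrite oner_eq0.
Qed.

Lemma pindependentS {X Y} : X `<=` Y -> pindependent delta Y ->
  pindependent delta X.
Proof.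
move=> XY Yind a Xa; apply: contra_not (Yind a (XY _ Xa)).
by apply: pclosureS => c [/XY Yc ca].
Qed.

(** If [Q] separates [c] from the rest of [X], subtracting a multiple of a polynomial that vanishes
    on [X] but not at [a] makes it vanish at [a] too, with its values on [X] unchanged. *)
Lemma pindependentU1 {X a} : pindependent delta X -> ~ cl X a ->
  pindependent delta (a |` X).
Proof.
move=> Xind Xa c [->{c}|Xc].
  by apply: contra_not Xa; apply: pclosureS => d [[->//|//]] /(_ erefl).
have [P XP Pa] := notin_pclosureP.1 Xa.
have [Q XQ Qc] := notin_pclosureP.1 (Xind _ Xc).
apply/notin_pclosureP; exists (Q - skew_eval Q a *: P).
  move=> d [[->|Xd] dc]; rewrite skew_evalB skew_evalZ.
    by rewrite Pa mulr1 subrr.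
  by rewrite XQ // XP // mulr0 subrr.
by rewrite skew_evalB skew_evalZ Qc XP // mulr0 subr0.
Qed.

Lemma dual_basis {X} : pindependent delta X ->
  exists p : 'cV[F]_n -> skewpoly delta,
    forall c d, X c -> X d -> skew_eval (p c) d = (c == d)%:R.
Proof.
move=> Xind.
have /choice[p pE] (c : 'cV[F]_n) : exists P,
    X c -> I (X `\ c) P /\ skew_eval P c = 1.
  have [Xc|nXc] := pselect (X c); last by exists 0.
  by have [P XP Pc] := notin_pclosureP.1 (Xind _ Xc); exists P.
exists p => c d Xc Xd; have [XP Pc] := pE _ Xc.
have [<-//|/eqP cd] := eqVneq c d.
by apply: XP; split => // dc; apply: cd.
Qed.

Lemma set_cons a s : [set` a :: s] = a |` [set` s].
Proof.
apply/seteqP; split=> c /=; rewrite in_cons.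
  by case/orP=> [/eqP->|]; [left|right].
by case=> [/eqP->//|->]; rewrite orbT.
Qed.

Lemma extract_independent t : exists s,
  [/\ uniq s, {subset s <= t}, pindependent delta [set` s]
    & cl [set` s] = cl [set` t]].
Proof.
elim: t => [|a t [s [sU st sind sE]]].
  by exists [::]; split=> //; rewrite (_ : [set` _] = set0) //; apply/seteqP.
have [sa|nsa] := pselect (cl [set` s] a).
  exists s; split=> //; first by move=> c /st; rewrite in_cons orbC => ->.
  rewrite set_cons -pclosureUr -sE; apply/seteqP; split.
    by move=> c sc; apply: sub_pclosure; right.
  by apply: pclosure_min => c [->|].
exists (a :: s); split.
- by rewrite /= sU andbT; apply/negP => sa; apply/nsa/sub_pclosure.
- by move=> c; rewrite !in_cons => /orP[->//|/st ->]; rewrite orbT.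
- by rewrite set_cons; apply: pindependentU1.
- by rewrite !set_cons -pclosureUr sE pclosureUr.
Qed.

(** The weights are the values at [c] of the polynomials dual to an independent sublist; they sum to
    1 because the constant 1 is expanded too. Conversely, the product rule turns [P = \sum_d P mu_d]
    at [c] into [\sum_d P(d) mu_d], which is zero. *)
Lemma pclosure_expansion t c : cl [set` t] c <->
  exists s (mu : 'cV[F]_n -> F),
    [/\ uniq s, {subset s <= t}, \sum_(d <- s) mu d = 1
      & forall d, d \in s -> conj_link delta c (mu d) d].
Proof.
split=> [tc|[s [mu [sU st mu1 muE]]] P tP]; last first.
  rewrite -[P]mulr1 -[1]scale1r -mu1 scaler_suml mulr_sumr skew_eval_sum.
  rewrite big_seq big1 // => d sd.
  by rewrite (skew_eval_link _ (muE _ sd)) tP ?mul0r //; apply: st.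
have [s [sU st sind sE]] := extract_independent t.
move: tc; rewrite -sE => sc.
have [p pE] := dual_basis sind.
have expand P : skew_eval P c = \sum_(d <- s) skew_eval P d * skew_eval (p d) c.
  have /sc : I [set` s] (P - \sum_(d <- s) skew_eval P d *: p d).
    move=> e /= se; rewrite skew_evalB skew_eval_sum (bigD1_seq e) //=.
    rewrite skew_evalZ pE // eqxx mulr1 big_seq_cond big1 ?addr0 ?subrr //.
    move=> d /andP[sd de]; rewrite skew_evalZ pE //.
    by rewrite (negPf de) mulr0.
  rewrite skew_evalB skew_eval_sum => /eqP; rewrite subr_eq0 => /eqP ->.
  by apply: eq_bigr => d _; rewrite skew_evalZ.
exists s, (fun d => skew_eval (p d) c); split=> //.
  have := expand 1; rewrite -[1]scale1r skew_evalC => ->.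
  by apply: eq_bigr => d _; rewrite skew_evalC mul1r.
(* Evaluate [x_i p_d], which vanishes on [s] except at [d], at the point [c]. *)
move=> d sd; apply/matrixP => i j; rewrite ord1 col_scaleE.
rewrite -skew_eval_varC -skew_evalM expand (bigD1_seq d) //=.
rewrite skew_evalM pE // eqxx scale1r mulr1 skew_eval_var.
rewrite big_seq_cond big1 ?addr0 // => e /andP[se ed].
rewrite skew_evalM pE // eq_sym (negPf ed) scale0r mulr0 skew_eval0 mul0r.
by [].
Qed.

(** Gaussian elimination: more vectors than functionals leaves a nontrivial combination killed by
    all of them. Each step clears one functional with a pivot vector. *)
Lemma left_dependence {V : lmodType F} {T : eqType} (ev : T -> V -> F) :
  (forall x k u v, ev x (k *: u + v) = k * ev x u + ev x v) ->
  forall (t : seq T) (f : 'I_(size t).+1 -> V),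
  exists2 v : 'I_(size t).+1 -> F, exists i, v i != 0 &
    forall x, x \in t -> ev x (\sum_i v i *: f i) = 0.
Proof.
move=> evL; elim=> [|x t IH] f /=.
  by exists (fun=> 1) => //; exists ord0; apply: oner_neq0.
have [i0 pivot] : exists i0, forall i, ev x (f i0) = 0 -> ev x (f i) = 0.
  have [[i0 /eqP i0x]|f0] := pselect (exists i, ev x (f i) <> 0).
    by exists i0 => i /eqP; rewrite (negPf i0x).
  by exists ord0 => i _; apply: contra_notP f0 => ?; exists i.
pose k i := ev x (f i) * (ev x (f i0))^-1.
have [v [i vi] vt] := IH (fun i => f (lift i0 i) - k (lift i0 i) *: f i0).
(* The coefficient at the pivot collects all the multiples of [f i0] subtracted from the other
   vectors. *)
pose w := fun j => if unlift i0 j is Some i then v i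
  else - \sum_i v i * k (lift i0 i).
have wE : \sum_j w j *: f j =
    \sum_i v i *: (f (lift i0 i) - k (lift i0 i) *: f i0).
  rewrite (bigD1_ord i0) //= /w unlift_none scaleNr addrC scaler_suml -sumrB.
  by apply: eq_bigr => j _; rewrite liftK scalerBr scalerA.
exists w; first by exists (lift i0 i); rewrite /w liftK.
have ev0 y : ev y 0 = 0.
  by have := evL y 1 0 0; rewrite scale1r addr0 mul1r => /eqP;
    rewrite -subr_eq0 opprD addrA subrr sub0r oppr_eq0 => /eqP.
have evs y (g : 'I_(size t).+1 -> V) :
    ev y (\sum_i v i *: g i) = \sum_i v i * ev y (g i).
  elim/big_rec2: _ => // j u r _ <-; exact: evL.
move=> y; rewrite in_cons wE => /orP[/eqP->|/vt//].
rewrite evs big1 // => j _.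
rewrite addrC -scaleNr evL mulNr /k.
have [/pivot ->|nz] := eqVneq (ev x (f i0)) 0.
  by rewrite mul0r mul0r oppr0 addr0 mulr0.
by rewrite mulrVK ?divF // addrC subrr mulr0.
Qed.

(** If [s] were longer, some nontrivial combination of its dual polynomials would vanish on [t],
    hence on the closure of [t], hence on [s]; but its values on [s] are its coefficients. *)
Lemma size_independent {s t} : uniq s -> pindependent delta [set` s] ->
  [set` s] `<=` cl [set` t] -> (size s <= size t)%N.
Proof.
move=> sU sind st; rewrite leqNgt; apply/negP => ts.
have [p pE] := dual_basis sind.
pose c (i : 'I_(size t).+1) := nth 0 s i.
have lts (i : 'I_(size t).+1) : (i < size s)%N by apply: leq_trans ts.
have sc i : c i \in s by rewrite mem_nth.
have evL (d : 'cV[F]_n) k P Q :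
    skew_eval (k *: P + Q) d = k * skew_eval P d + skew_eval Q d.
  by rewrite skew_evalD skew_evalZ.
have [v [i /eqP vi] vt] := left_dependence _ evL t (fun i => p (c i)).
apply: vi; have := st _ (sc i) _ vt.
rewrite skew_eval_sum (bigD1 i) //= skew_evalZ pE; [|exact: sc|exact: sc].
rewrite eqxx mulr1 big1 ?addr0 //.
move=> j ji; rewrite skew_evalZ pE; [|exact: sc|exact: sc].
by rewrite nth_uniq // (inj_eq val_inj) (negPf ji) mulr0.
Qed.

Lemma fg_pclosedP X : fg_pclosed delta X <->
  exists s, [/\ uniq s, pindependent delta [set` s] & X = cl [set` s]].
Proof.
split=> [[clX [G /finite_seqP[t ->] [tX tE]]]|[s [sU sind ->]]].
  have [s [sU st sind sE]] := extract_independent t.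
  by exists s; split=> //; rewrite sE.
split; first exact: pclosureK.
by exists [set` s]; [exact: finite_seq | split; [exact: sub_pclosure|]].
Qed.

Lemma fg_pclosure {X} : finite_set X -> fg_pclosed delta (cl X).
Proof.
move=> Xf; split; first exact: pclosureK.
by exists X => //; split; [exact: sub_pclosure|].
Qed.

(** Otherwise any finite independent list in [X] could be extended by a point outside its closure,
    eventually exceeding the length of a generating list of [Y]. *)
Lemma fg_pclosedS X Y : pclosed delta X -> fg_pclosed delta Y -> X `<=` Y ->
  fg_pclosed delta X.
Proof.
move=> clX [_ [G /finite_seqP[t ->] [_ tY]]] XY.
apply: contrapT => Xnfg.
have grow k : exists s,
    [/\ uniq s, size s = k, pindependent delta [set` s] & [set` s] `<=` X].
  elim: k => [|k [s [sU sk sind sX]]].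
    exists [::]; split=> //; rewrite (_ : [set` _] = set0) //; exact/seteqP.
  have [a Xa nsa] : exists2 a, X a & ~ cl [set` s] a.
    apply: contrapT => /forall2NP Xs; apply: Xnfg; apply/fg_pclosedP.
    exists s; split=> //; apply/seteqP; split=> [a Xa|].
      by apply: contrapT; case: (Xs a).
    by rewrite -clX; apply: pclosureS.
  exists (a :: s); split=> //=; last 2 first.
  - by rewrite set_cons; apply: pindependentU1.
  - by rewrite set_cons => c [->|/sX].
  - by rewrite sU andbT; apply/negP => sa; apply/nsa/sub_pclosure.
  - by rewrite sk.
have [s [sU sk sind sX]] := grow (size t).+1.
have : (size s <= size t)%N.
  by apply: size_independent => //; rewrite tY; apply: subset_trans XY.
by rewrite sk ltnn.
Qed.

(** An infinite P-basis would contain more independent points than there are generators. *)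
Lemma pbasis_seq {X B} : fg_pclosed delta X -> pbasis delta X B ->
  exists s, uniq s /\ B = [set` s].
Proof.
move=> [_ [G /finite_seqP[t ->] [_ tX]]] [[BX _] Bind].
have [|Binf] := pselect (finite_set B).
  move=> /finite_seqP[s ->]; exists (undup s); split; first exact: undup_uniq.
  by apply/seteqP; split=> c /=; rewrite mem_undup.
have [A AB tA] := infinite_set_fset (size t).+1 Binf.
suff : (size A <= size t)%N by rewrite leqNgt tA.
apply: size_independent; first exact: fset_uniq.
  by apply: pindependentS Bind.
by rewrite tX; apply: subset_trans BX.
Qed.

Lemma card_seq {T : choiceType} (s : seq T) : uniq s ->
  ([set` s] #= `I_(size s))%card.
Proof.
move=> sU; have -> : [set` s] = [set` [fset x in s]%fset].
  by apply/seteqP; split=> x /=; rewrite inE.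
by apply/card_eq_fsetP; rewrite card_fseq undup_id.
Qed.

Lemma prank_pbasis {X s} : fg_pclosed delta X -> uniq s ->
  pbasis delta X [set` s] -> prank delta X = size s.
Proof.
move=> Xfg sU sX; apply: xget_unique => [|k [B BX Bk]].
  by exists [set` s] => //; apply: card_seq.
have [t [tU tE]] := pbasis_seq Xfg BX; move: BX Bk; rewrite {}tE => tX tk.
have -> : k = size t.
  by apply/card_eq_II; rewrite (card_eq_trans _ (card_seq _ tU)) // card_eq_sym.
apply/eqP; rewrite eqn_leq.
case: sX tX => [[sX1 sX2] sind] [[tX1 tX2] tind].
by rewrite !size_independent // ?sX2 // tX2.
Qed.

Lemma pbasis_exists {X} : fg_pclosed delta X -> exists B, pbasis delta X B.
Proof.
move/fg_pclosedP=> [s [sU sind ->]]; exists [set` s].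
by split=> //; split=> //; apply: sub_pclosure.
Qed.

End PClosure.

(** * Splitting of closures along conjugacy classes *)

Section Conjugacy.
Context {F : unitRingType} (divF : division_ring F).
Context {n : nat} {sigma : {rmorphism F -> 'M[F]_n}}.
Context {delta : skew_derivation sigma}.
Implicit Types (P Q : skewpoly delta) (a c d : 'cV[F]_n) (b k : F).
Implicit Types (X Y : set 'cV[F]_n) (s t : seq 'cV[F]_n).

Local Notation cl := (pclosure delta).
Local Notation I := (vanishing_ideal (delta := delta)).
Local Notation link := (conj_link delta).
Local Notation C := (conj_class delta).

Lemma division_ring_unitE b : (b \is a GRing.unit) = (b != 0).
Proof.
by apply/idP/idP => [|/divF//]; apply: contraTneq => ->; rewrite unitr0.
Qed.

Lemma conj_byP {a b c} : b != 0 -> link a b c <-> conj_by delta a b = c.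
Proof.
move=> /divF bU; rewrite /conj_by /conj_link; split=> [->|<-].
  by rewrite -mulmxA -scalar_mxM divrr // mulmx1.
by rewrite -mulmxA -scalar_mxM mulVr // mulmx1.
Qed.

Lemma conj_classP {a c} : C a c <-> exists2 b, b != 0 & link a b c.
Proof. by split=> -[b b0 /(conj_byP b0) bE]; exists b. Qed.

Lemma conj_class_sym {a c} : C a c -> C c a.
Proof.
move=> /conj_classP[b /divF bU acb]; apply/conj_classP; exists b^-1.
  by rewrite -division_ring_unitE unitrV.
exact: conj_linkV.
Qed.

Lemma conj_class_trans {a c d} : C a c -> C c d -> C a d.
Proof.
move=> /conj_classP[b b0 acb] /conj_classP[k k0 cdk].
apply/conj_classP; exists (k * b); last exact: conj_linkM acb cdk.
by rewrite -division_ring_unitE unitrMl divF.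
Qed.

(** In an expansion of [c], dropping the zero weights leaves only points conjugate to [c]. For the
    converse, weights of sum 1 cannot all vanish, so [c] is conjugate to some point of [X] in the
    class. *)
Lemma pclosure_conj {X} a : finite_set X -> cl X `&` C a = cl (X `&` C a).
Proof.
move=> Xf; apply/seteqP; split=> [c [Xc ac]|c].
  move: Xc ac; have /finite_seqP[t ->] := Xf => /(pclosure_expansion divF).
  move=> [s [mu [sU st mu1 muE]]] ac.
  have /(pclosureS (delta := delta)) :
      [set` [seq d <- s | mu d != 0]] `<=` [set` t] `&` C a.
    move=> d /=; rewrite mem_filter => /andP[d0 sd]; split; first exact: st.
    by apply: conj_class_trans ac _; apply/conj_classP; exists (mu d); auto.
  apply; apply/(pclosure_expansion divF).
  exists [seq d <- s | mu d != 0], mu; split=> //; first exact: filter_uniq.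
    rewrite big_filter -{}mu1 [RHS](bigID (fun d => mu d == 0)) /=.
    by rewrite [X in _ = X + _]big1 ?add0r // => d /eqP.
  by move=> d; rewrite mem_filter => /andP[_]; apply: muE.
move=> Xc; split; first by apply: pclosureS Xc => d [].
have /finite_seqP[t tE] : finite_set (X `&` C a) by exact: finite_setIl.
move: Xc; rewrite tE => /(pclosure_expansion divF)[s [mu [sU st mu1 muE]]].
have [d sd d0] : exists2 d, d \in s & mu d != 0.
  apply: contrapT => /forall2NP s0; have := oner_neq0 F; rewrite -mu1.
  rewrite big_seq big1 ?eqxx // => d sd.
  by have [//|/negP] := s0 d; rewrite negbK => /eqP.
have : (X `&` C a) d by rewrite tE; apply: st.
case=> _ ad; apply: conj_class_trans ad _; apply: conj_class_sym.
by apply/conj_classP; exists (mu d); auto.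
Qed.

(** Otherwise [pclosure_conj] would put [c] in the closure of the empty set, which the constant 1
    shows to be empty. *)
Lemma pclosure_class {X c} : finite_set X -> cl X c ->
  exists2 d, X d & C d c.
Proof.
move=> Xf Xc.
have : cl (X `&` C c) c.
  rewrite -pclosure_conj //; split=> //; apply/conj_classP; exists 1.
    exact: oner_neq0.
  exact: conj_link1.
apply: contraPP => /forall2NP Xd; rewrite (_ : _ `&` _ = set0).
  apply/(notin_pclosureP divF); exists 1%:A => [d []|].
  exact: skew_evalC.
apply/seteqP; split=> // d [] ? /conj_class_sym ?.
by case: (Xd d).
Qed.

(* For [b != 0], membership means that the conjugate of [a] by [b] lies in   *)
(* the P-closure of [X].                                                     *)
Definition conj_space a X : set F :=
  [set b | forall P, I X P -> skew_eval (P * b%:A) a = 0].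

Lemma conj_spaceP {a b c X} : b != 0 -> link a b c ->
  conj_space a X b <-> cl X c.
Proof.
move=> /divF bU abc; split=> Xb P /Xb.
  by rewrite (skew_eval_link _ abc) => /(canRL (mulrK bU)); rewrite mul0r.
by rewrite (skew_eval_link _ abc) => ->; rewrite mul0r.
Qed.

Lemma conj_space_pclosure a X : conj_space a (cl X) = conj_space a X.
Proof. by rewrite /conj_space vanishing_pclosure. Qed.

Lemma conj_spaceS a X Y : X `<=` Y -> conj_space a X `<=` conj_space a Y.
Proof. by move=> XY b Xb P YP; apply: Xb => c /XY /YP. Qed.

Lemma conj_linkE {a b} : b != 0 -> link a b (conj_by delta a b).
Proof. by move=> b0; apply/conj_byP. Qed.

End Conjugacy.

(** * Right subspaces and their projective spaces *)

Section RightSubspaces.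
Context {F : unitRingType}.
Implicit Types (K V W : set F).

Definition right_subspace K V :=
  [/\ V 0, forall x y, V x -> V y -> V (x + y)
    & forall x k, V x -> K k -> V (x * k)].

Lemma right_subspace_sum K V I (r : seq I) (p : pred I) (f : I -> F) :
  right_subspace K V -> (forall i, p i -> V (f i)) ->
  V (\sum_(i <- r | p i) f i).
Proof. by move=> [V0 VD _] Vf; elim/big_ind: _. Qed.

Lemma subspace_of_proj {K V} : K 1 -> right_subspace K V ->
  subspace_of (proj_of K V) = V.
Proof.
move=> K1 [V0 VD VM]; apply/seteqP; split=> x.
  by case=> [->//|[_ [y [Vy _] <-] [k [Kk _] <-]]]; apply: VM.
have [->|/eqP x0] := eqVneq x 0; first by left.
move=> Vx; right; exists (proj_point K x); first by exists x.
by exists 1; [split=> //; apply: oner_neq0 | rewrite mulr1].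
Qed.

(** A common point has representatives [x] in [V] and [y] in [W]; as [x] is a right [K]-multiple of
    [y], it lies in [W] as well. *)
Lemma proj_ofI {K V W} : K 1 -> right_subspace K W ->
  proj_of K V `&` proj_of K W = proj_of K (V `&` W).
Proof.
move=> K1 [_ _ WM]; apply/seteqP; split=> [p|p [x [[Vx Wx] x0] <-]]; last first.
  by split; exists x.
move=> [[x [Vx x0] <-] [y [Wy y0] /seteqP[_]]] => /(_ x)[].
  by exists 1; [split=> //; apply: oner_neq0 | rewrite mulr1].
move=> k [Kk _] xE; exists x => //; split=> //; split=> //.
by rewrite -xE; apply: WM.
Qed.

Lemma right_span_subspace {K m} {b : 'I_m -> F} :
  K 0 -> (forall x y, K x -> K y -> K (x + y)) ->
  (forall x y, K x -> K y -> K (x * y)) -> right_subspace K (right_span K b).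
Proof.
move=> K0 KD KM; split.
- by exists (fun=> 0) => //; apply: big1 => i _; rewrite mulr0.
- move=> _ _ [f Kf <-] [g Kg <-]; exists (fun i => f i + g i).
    by move=> i; apply: KD.
  by rewrite /right_comb -big_split; apply: eq_bigr => i _; rewrite mulrDr.
- move=> _ k [f Kf <-] Kk; exists (fun i => f i * k).
    by move=> i; apply: KM.
  by rewrite /right_comb mulr_suml; apply: eq_bigr => i _; rewrite mulrA.
Qed.

Lemma right_span_gen {K m} (b : 'I_m -> F) i :
  K 0 -> K 1 -> right_span K b (b i).
Proof.
move=> K0 K1; exists (fun j => (i == j)%:R); first by move=> j; case: eqP.
rewrite /right_comb (bigD1 i) //= eqxx mulr1 big1 ?addr0 // => j /negPf.
by rewrite eq_sym => ->; rewrite mulr0.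
Qed.

Lemma right_free_neq0 {K m} {b : 'I_m -> F} i : K 0 -> K 1 ->
  right_free K b -> b i != 0.
Proof.
move=> K0 K1 bfree; apply/eqP => bi.
pose l j : F := (i == j)%:R.
have Kl j : K (l j) by rewrite /l; case: (i == j).
have bl0 : right_comb b l = 0.
  apply: big1 => j _; rewrite /l; have [<-|] := eqVneq i j.
    by rewrite bi mul0r.
  by rewrite mulr0.
by have /eqP := bfree l Kl bl0 i; rewrite /l eqxx oner_eq0.
Qed.

End RightSubspaces.

(** * The space of conjugators from a fixed point into a P-closed set *)

Section ConjugateSpaces.
Context {F : unitRingType} (divF : division_ring F).
Context {n : nat} {sigma : {rmorphism F -> 'M[F]_n}}.
Context {delta : skew_derivation sigma}.
Implicit Types (P Q : skewpoly delta) (a c d : 'cV[F]_n) (b k : F).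
Implicit Types (X Y : set 'cV[F]_n) (s t : seq 'cV[F]_n).

Local Notation cl := (pclosure delta).
Local Notation I := (vanishing_ideal (delta := delta)).
Local Notation link := (conj_link delta).
Local Notation C := (conj_class delta).
Local Notation K := (centralizer delta).
Local Notation conj_space := (conj_space (delta := delta)).

Lemma centralizer0 a : K a 0. Proof. exact: conj_link0. Qed.
Lemma centralizer1 a : K a 1. Proof. exact: conj_link1. Qed.

Lemma centralizerM {a b k} : K a b -> K a k -> K a (b * k).
Proof. by move=> ab ak; apply: conj_linkM ak ab. Qed.

(** Stability under scalars is the product rule at a link from [a] to itself. *)
Lemma conj_space_subspace a X : right_subspace (K a) (conj_space a X).
Proof.
split.
- by move=> P _; rewrite scale0r mulr0 skew_eval0.
- move=> x y Xx Xy P XP.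
  rewrite scalerDl mulrDr skew_evalD -[RHS]addr0.
  by congr (_ + _); [exact: Xx | exact: Xy].
- move=> x k Xx ak P XP.
  rewrite -scalerA -[k%:A in X in skew_eval X]mul1r scalerAl mulrA.
  by rewrite (skew_eval_link _ ak) Xx // mul0r.
Qed.

Lemma right_span_centralizer {a m} {b : 'I_m -> F} :
  right_subspace (K a) (right_span (K a) b).
Proof.
apply: right_span_subspace; first exact: centralizer0.
  by move=> x y; apply: conj_linkD.
by move=> x y; apply: centralizerM.
Qed.

(** If [b] conjugates [a] to [c] and [c] has weights [mu], then [b] is the sum of the [mu d * b],
    and each nonzero term conjugates [a] to [d]. *)
Lemma conj_space_min {a X V} : finite_set X -> right_subspace (K a) V ->
  (forall d, X d -> C a d -> exists b, [/\ b != 0, link a b d & V b]) ->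
  conj_space a X `<=` V.
Proof.
move=> Xf Vsub XV b Xb.
have [->|b0] := eqVneq b 0; first by case: Vsub.
have bU := divF _ b0; have ab : link a b _ := conj_linkE divF b0.
move: Xb => /(conj_spaceP divF b0 ab).
move: Xf XV => /finite_seqP[t ->] tV /(pclosure_expansion divF).
move=> [s [mu [sU st mu1 muE]]].
rewrite -[b]mul1r -mu1 mulr_suml big_seq.
apply: (right_subspace_sum (K a)) => // d sd.
have [->|d0] := eqVneq (mu d) 0; first by rewrite mul0r; case: Vsub.
have ad := conj_linkM ab (muE _ sd).
have mub0 : mu d * b != 0.
  by rewrite -(division_ring_unitE divF) unitrMr ?divF.
have [|k [k0 ak Vk]] := tV _ (st _ sd).
  by apply/(conj_classP divF); exists (mu d * b).
(* Two conjugators from [a] to [d] differ by a right factor in the centralizer. *)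
rewrite -[mu d * b](mulVKr (divF _ k0)); case: Vsub => _ _; apply=> //.
exact: conj_linkM ad (conj_linkV (divF _ k0) ak).
Qed.

(** A basis consists of one conjugator for each point of [s] in the class of [a]: it spans by
    [conj_space_min], and the dual polynomials of [s] make it free. *)
Lemma conj_space_fin_dim {a X} : fg_pclosed delta X ->
  fin_dim_subspace (K a) (conj_space a X).
Proof.
move=> /(fg_pclosedP divF)[s [sU sind ->]]; rewrite conj_space_pclosure.
have /choice[w wE] c : exists b, C a c -> b != 0 /\ link a b c.
  have [/(conj_classP divF)[b b0 acb]|nac] := pselect (C a c); last by exists 0.
  by exists b.
pose r := [seq d <- s | `[< C a d >]].
have rP i : r`_i \in s /\ C a r`_i \/ (size r <= i)%N.
  have [ir|] := ltnP i (size r); [left | by right].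
  by have := mem_nth 0 ir; rewrite mem_filter => /andP[/asboolP].
have rI (i : 'I_(size r)) : r`_i \in s /\ C a r`_i.
  by have [//|] := rP i; rewrite leqNgt ltn_ord.
pose b (i : 'I_(size r)) := w r`_i.
exists (size r), b; split.
  move=> l al l0 i; have [p pE] := dual_basis divF sind.
  have [si ai] := rI i; have [bi0 abi] := wE _ ai.
  (* Evaluating at [a] the dual polynomial times the combination isolates the [i]-th term. *)
  have : skew_eval (p r`_i * (right_comb b l)%:A) a = b i * l i.
    rewrite /right_comb scaler_suml mulr_sumr skew_eval_sum (bigD1 i) //=.
    have E j : skew_eval (p r`_i * (b j * l j)%:A) a =
        (i == j)%:R * b j * l j.
      have [sj aj] := rI j; have [_ abj] := wE _ aj.
      rewrite (skew_eval_link _ (conj_linkM (al j) abj)) pE // mulrA.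
      by rewrite nth_uniq //; exact: filter_uniq.
    rewrite [X in X + _]E eqxx mul1r [X in _ + X]big1 ?addr0 // => j ji.
    by rewrite (E j) eq_sym (negPf ji) !mul0r.
  rewrite l0 scale0r mulr0 skew_eval0 => /esym bl0.
  by rewrite -[l i](mulKr (divF _ bi0)) bl0 mulr0.
apply/seteqP; split=> [_ [l al <-]|].
  have [_ _ VM] := conj_space_subspace a [set` s].
  apply: (right_subspace_sum (K a)) => [|i _]; first exact: conj_space_subspace.
  apply: VM (al i); have [si ai] := rI i; have [bi0 abi] := wE _ ai.
  by apply/(conj_spaceP divF bi0 abi); apply: sub_pclosure.
apply: conj_space_min; [exact: finite_seq|exact: right_span_centralizer|].
move=> d sd ad; have [d0 wd] := wE _ ad; exists (w d); split=> //.
have rd : d \in r by rewrite mem_filter sd andbT; apply/asboolP.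
have dr : (index d r < size r)%N by rewrite index_mem.
have -> : w d = b (Ordinal dr) by rewrite /b nth_index.
by apply: right_span_gen; [apply: centralizer0|apply: centralizer1].
Qed.

Lemma fin_dim_subspace_centralizer {a V} : fin_dim_subspace (K a) V ->
  right_subspace (K a) V.
Proof. by move=> [m [b [_ <-]]]; apply: right_span_centralizer. Qed.

Lemma conj_space_psum {a X Y} : fg_pclosed delta X -> fg_pclosed delta Y ->
  conj_space a (psum delta X Y) =
  [set x + y | x in conj_space a X & y in conj_space a Y].
Proof.
move=> [_ [G Gf [_ <-]]] [_ [H Hf [_ <-]]].
rewrite /psum pclosureUl pclosureUr !conj_space_pclosure.
have [G0 GD GM] := conj_space_subspace a G.
have [H0 HD HM] := conj_space_subspace a H.
have [U0 UD UM] := conj_space_subspace a (G `|` H).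
apply/seteqP; split=> [|_ [x Gx [y Hy <-]]]; last first.
  apply: UD; first exact: conj_spaceS Gx.
  by apply: conj_spaceS Hy.
(* The sum is itself a subspace, and it contains a conjugator for each generator in the class of
   [a]. *)
apply: conj_space_min; first by rewrite finite_setU.
  split.
  - by exists 0 => //; exists 0 => //; rewrite addr0.
  - move=> _ _ [x Gx [y Hy <-]] [x' Gx' [y' Hy' <-]].
    exists (x + x'); first exact: GD.
    by exists (y + y'); [exact: HD | rewrite addrACA].
  - move=> _ k [x Gx [y Hy <-]] ak; exists (x * k); first exact: GM.
    by exists (y * k); [exact: HM | rewrite mulrDl].
move=> d GHd /(conj_classP divF)[b b0 abd]; exists b; split=> //.
have Vb Z : Z d -> conj_space a Z b.
  by move=> Zd; apply/(conj_spaceP divF b0 abd); apply: sub_pclosure.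
case: GHd => /Vb.
  by exists b => //; exists 0 => //; rewrite addr0.
by exists 0 => //; exists b => //; rewrite add0r.
Qed.

Lemma conj_spaceI {a X Y} : pclosed delta X -> pclosed delta Y ->
  conj_space a (X `&` Y) = conj_space a X `&` conj_space a Y.
Proof.
move=> clX clY; apply/seteqP; split=> b.
  by move=> XYb; split; apply: conj_spaceS XYb => c [].
have [->|b0] := eqVneq b 0 => -[Xb Yb].
  by have [] := conj_space_subspace a (X `&` Y).
have ab : link a b _ := conj_linkE divF b0.
apply/(conj_spaceP divF b0 ab); apply: (sub_pclosure (X `&` Y)).
by split; [rewrite -clX | rewrite -clY]; apply: (conj_spaceP divF b0 ab).1.
Qed.

End ConjugateSpaces.

(** * Unions over pairwise non-conjugate classes *)

Section NonConjugate.
Context {F : unitRingType} (divF : division_ring F).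
Context {n : nat} {sigma : {rmorphism F -> 'M[F]_n}}.
Context {delta : skew_derivation sigma}.
Context {l : nat} {a : 'I_l -> 'cV[F]_n}.

Local Notation cl := (pclosure delta).
Local Notation C := (conj_class delta).
Local Notation K := (centralizer delta).
Local Notation conj_space := (conj_space (delta := delta)).
Local Notation classes := (\bigcup_i C (a i)).

Lemma pclosure_sub_classes {X : set 'cV[F]_n} : finite_set X ->
  X `<=` classes -> cl X `<=` classes.
Proof.
move=> Xf XC c /(pclosure_class divF Xf)[d /XC[i _ aid] dc].
by exists i => //; apply: (conj_class_trans divF) aid dc.
Qed.

Hypothesis nonconj : forall i j, i <> j -> ~ C (a i) (a j).

Lemma conj_class_inj {i j c} : C (a i) c -> C (a j) c -> i = j.
Proof.
move=> aic /(conj_class_sym divF) caj; apply: contrapT => /nonconj; apply.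
exact: (conj_class_trans divF) aic caj.
Qed.

Lemma bigcup_classI {X : 'I_l -> set 'cV[F]_n} j :
  (forall i, X i `<=` C (a i)) -> (\bigcup_i X i) `&` C (a j) = X j.
Proof.
move=> XC; apply/seteqP; split=> [c [[i _ Xic]] | c Xjc].
  by move/(conj_class_inj (XC _ _ Xic)) <-.
by split; [exists j | apply: XC].
Qed.

(** A point of the closure lies in some class [C (a i)], and cutting the union down to that class
    leaves only [X i]. *)
Lemma pclosure_bigcup {X : 'I_l -> set 'cV[F]_n} :
  (forall i, finite_set (X i)) -> (forall i, X i `<=` C (a i)) ->
  cl (\bigcup_i X i) = \bigcup_i cl (X i).
Proof.
move=> Xf XC; apply/seteqP; split=> [c Xc|c [i _]]; last first.
  by apply: pclosureS => d Xd; exists i.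
have Uf : finite_set (\bigcup_i X i).
  by apply: bigcup_finite => //; exact: finite_finset.
have [d Xd|i _ aic] := pclosure_sub_classes Uf _ _ Xc.
  by case: Xd => i _ /XC; exists i.
by exists i => //; rewrite -(bigcup_classI i XC) -pclosure_conj.
Qed.

Section Union.
Context {X : 'I_l -> set 'cV[F]_n}.
Hypothesis XC : forall i, X i `<=` C (a i).
Hypothesis Xfg : forall i, fg_pclosed delta (X i).

Lemma pbasis_bigcup (B : 'I_l -> set 'cV[F]_n) :
  (forall i, pbasis delta (X i) (B i)) ->
  pbasis delta (\bigcup_i X i) (\bigcup_i B i).
Proof.
move=> BX.
have Bf i : finite_set (B i).
  have [s [_ ->]] := pbasis_seq divF (Xfg i) (BX i); exact: finite_seq.
have BC i : B i `<=` C (a i).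
  by have [[BiX _] _] := BX i; apply: subset_trans (XC i).
split.
  split=> [c [i _ Bic]|].
    by have [[BiX _] _] := BX i; exists i => //; apply: BiX.
  rewrite pclosure_bigcup //; apply: eq_bigcupr => i _.
  by have [[_ ->] _] := BX i.
move=> c [i _ Bic] Bc; have [_ /(_ c Bic)] := BX i; apply.
have Df : finite_set ((\bigcup_i B i) `\ c).
  by apply: finite_setD; apply: bigcup_finite => //; exact: finite_finset.
(* Cutting the dependence of [c] down to its class leaves one inside [B i]. *)
have : (cl ((\bigcup_i B i) `\ c) `&` C (a i)) c by split=> //; apply: BC Bic.
rewrite pclosure_conj //; apply: pclosureS => d [[Bd dc] aid].
by split=> //; rewrite -(bigcup_classI i BC).
Qed.

Lemma fg_pclosed_bigcup : fg_pclosed delta (\bigcup_i X i).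
Proof.
have /choice[B BX] i := pbasis_exists divF (Xfg i).
have [[_ <-] _] := pbasis_bigcup B BX; apply: fg_pclosure.
apply: bigcup_finite => [|i _]; first exact: finite_finset.
have [s [_ ->]] := pbasis_seq divF (Xfg i) (BX i); exact: finite_seq.
Qed.

Lemma prank_bigcup :
  prank delta (\bigcup_i X i) = (\sum_(i < l) prank delta (X i))%N.
Proof.
have /choice[B BX] i := pbasis_exists divF (Xfg i).
have /choice[s sE] i := pbasis_seq divF (Xfg i) (BX i).
have sX i : pbasis delta (X i) [set` s i].
  by have [_ <-] := sE i.
pose u := flatten [seq s i | i <- enum 'I_l].
have uE : [set` u] = \bigcup_i [set` s i].
  apply/seteqP; split=> [c /flatten_mapP[i _ ic]|c [i _ ic]]; first by exists i.
  by apply/flatten_mapP; exists i => //; rewrite mem_enum.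
have sC i c : c \in s i -> C (a i) c.
  by have [[sXi _] _] := sX i; move=> /sXi /XC.
(* Lists for different indices share no point, since their classes are disjoint. *)
have uU : uniq u.
  rewrite /u; elim: (enum 'I_l) (enum_uniq 'I_l) => //= i e IH /andP[ie eU].
  rewrite cat_uniq IH // andbT; have [-> _] := sE i.
  apply/hasPn => c /flatten_mapP[j je jc]; apply/negP => ic.
  by move: ie; rewrite (conj_class_inj (sC _ _ ic) (sC _ _ jc)) je.
rewrite (prank_pbasis divF fg_pclosed_bigcup uU); last first.
  by rewrite uE; apply: pbasis_bigcup.
rewrite size_flatten /shape -map_comp sumnE big_map big_enum /=.
apply: eq_bigr => i _; have [siU _] := sE i.
by rewrite (prank_pbasis divF (Xfg i) siU).
Qed.

End Union.

(** * The lattice isomorphism *)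

Section Lattice.

Definition fg_pclosed_in : set (set 'cV[F]_n) :=
  [set X | fg_pclosed delta X /\ X `<=` classes].

Lemma fg_pclosed_in_psum {X Y} : fg_pclosed_in X -> fg_pclosed_in Y ->
  fg_pclosed_in (psum delta X Y).
Proof.
move=> [[_ [G Gf [GX GE]]] XC] [[_ [H Hf [HY HE]]] YC].
have E : psum delta X Y = cl (G `|` H).
  by rewrite -GE -HE /psum pclosureUl pclosureUr.
have GHf : finite_set (G `|` H) by rewrite finite_setU.
rewrite E; split; first exact: fg_pclosure.
by apply: pclosure_sub_classes => // c [/GX/XC|/HY/YC].
Qed.

Lemma fg_pclosed_inI {X Y} : fg_pclosed_in X -> fg_pclosed_in Y ->
  fg_pclosed_in (X `&` Y).
Proof.
move=> [Xfg XC] [[clY _] _]; split; last by move=> c [/XC].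
apply: (fg_pclosedS divF _ _ _ Xfg); last by move=> c [].
by apply: pclosedI => //; case: Xfg.
Qed.

Lemma fg_pclosed_in_lattice : is_lattice fg_pclosed_in (psum delta) setI.
Proof.
split=> [X Y CX CY|X Y _ _|X Y Z _ _ _|X Y [[clX _] _] [[clY _] _]].
- by split; [apply: fg_pclosed_in_psum | apply: fg_pclosed_inI].
- by rewrite /psum setUC setIC.
- by rewrite /psum pclosureUl pclosureUr setUA setIA.
- rewrite /psum setUidl; last by move=> c [].
  by split=> //; apply/setIidPl => c Xc; apply: sub_pclosure; left.
Qed.

(** This is the isomorphism: a point of [X] in [C (a i)] corresponds to the projective class of its
    conjugators from [a i]. *)
Definition proj_spaces (X : set 'cV[F]_n) : 'I_l -> set (set F) :=
  fun i => proj_of (K (a i)) (conj_space (a i) X).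

Lemma subspace_of_proj_spaces X i :
  subspace_of (proj_spaces X i) = conj_space (a i) X.
Proof.
by apply: subspace_of_proj; [exact: centralizer1|exact: conj_space_subspace].
Qed.

Lemma proj_spaces_inj : {in fg_pclosed_in &, injective proj_spaces}.
Proof.
suff sub X Y : fg_pclosed_in X -> fg_pclosed_in Y ->
    proj_spaces X = proj_spaces Y -> X `<=` Y.
  move=> X Y /set_mem CX /set_mem CY XY.
  by apply/seteqP; split; apply: sub.
move=> [_ XC] [[clY _] _] XY c Xc.
have [i _ /(conj_classP divF)[b b0 abc]] := XC _ Xc.
rewrite -clY; apply: (conj_spaceP divF b0 abc).1.
rewrite -subspace_of_proj_spaces -XY subspace_of_proj_spaces.
by apply: (conj_spaceP divF b0 abc).2; apply: (sub_pclosure X).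
Qed.

(** Take the closure of all conjugates of the [a i] by the vectors of a basis of [V i]. *)
Lemma proj_spaces_surj (V : 'I_l -> set F) :
  (forall i, fin_dim_subspace (K (a i)) (V i)) ->
  exists2 X, fg_pclosed_in X & forall i, conj_space (a i) X = V i.
Proof.
move=> Vfd.
pose X i := [set conj_by delta (a i) b | b in V i `\ 0].
have /choice[G GE] i : exists G : set 'cV[F]_n,
    [/\ finite_set G, G `<=` X i & V i `<=` conj_space (a i) G].
  have [m [b [bfree bV]]] := Vfd i.
  have b0 j : b j != 0.
    by apply: right_free_neq0 bfree; [exact: centralizer0|exact: centralizer1].
  have Vb j : V i (b j).
    by rewrite -bV; apply: right_span_gen;
      [exact: centralizer0|exact: centralizer1].
  exists (range (fun j => conj_by delta (a i) (b j))); split.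
  - by apply: finite_image; exact: finite_finset.
  - move=> _ [j _ <-]; exists (b j) => //; split=> //; exact/eqP.
  - rewrite -bV => _ [k Kk <-].
    have [_ _ VM] := conj_space_subspace (delta := delta) (a i)
      (range (fun j => conj_by delta (a i) (b j))).
    apply: (right_subspace_sum (K (a i))) => [|j _].
      exact: conj_space_subspace.
    apply: VM (Kk j).
    apply: (conj_spaceP divF (b0 j) (conj_linkE divF (b0 j))).2.
    by apply: sub_pclosure; exists j.
have Gf i : finite_set (G i) by have [] := GE i.
have GC i : G i `<=` C (a i).
  have [_ GX _] := GE i; move=> c /GX[b [_ /eqP b0] <-].
  by exists b.
have Uf : finite_set (\bigcup_i G i).
  by apply: bigcup_finite => //; exact: finite_finset.
exists (cl (\bigcup_i G i)) => [|i].
  split; first exact: fg_pclosure.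
  by apply: pclosure_sub_classes => // c [i _ /GC]; exists i.
rewrite conj_space_pclosure; have [_ GX VG] := GE i.
apply/seteqP; split=> [|b /VG]; last by apply: conj_spaceS => c; exists i.
apply: (conj_space_min divF) => //.
  exact: fin_dim_subspace_centralizer.
(* By non-conjugacy, a generator in the class of [a i] comes from [V i] itself. *)
move=> d Gd aid; have : ((\bigcup_i G i) `&` C (a i)) d by [].
rewrite bigcup_classI // => /GX[b [Vb /eqP b0] bE].
by exists b; split=> //; apply/(conj_byP divF b0).
Qed.

Lemma proj_spaces_iso :
  lattice_isomorphic fg_pclosed_in (psum delta) setI
    [set L : 'I_l -> set (set F) |
      forall i, fin_dim_proj_subspace (K (a i)) (L i)]
    (pointwise (fun i => proj_sum (K (a i)))) (pointwise (fun _ => setI)).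
Proof.
exists proj_spaces; split.
- split=> [X [Xfg _] i||L LK].
  + by exists (conj_space (a i) X) => //; apply: conj_space_fin_dim.
  + exact: proj_spaces_inj.
  + have /choice[V VE] i : exists V,
        fin_dim_subspace (K (a i)) V /\ L i = proj_of (K (a i)) V.
      by have [V] := LK i; exists V.
    have [i|X CX XV] := proj_spaces_surj V; first by have [] := VE i.
    exists X => //; apply: functional_extensionality_dep => i.
    by rewrite /proj_spaces XV; have [_ <-] := VE i.
- move=> X Y [Xfg _] [Yfg _]; apply: functional_extensionality_dep => i.
  rewrite /pointwise /proj_sum !subspace_of_proj_spaces.
  by rewrite -(conj_space_psum divF Xfg Yfg).
- move=> X Y [[clX _] _] [[clY _] _].
  apply: functional_extensionality_dep => i.
  rewrite /pointwise /proj_spaces (conj_spaceI divF clX clY).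
  apply/esym/proj_ofI; [exact: centralizer1 | exact: conj_space_subspace].
Qed.

End Lattice.

End NonConjugate.

Theorem theorem5 (F : unitRingType) (divF : division_ring F)
    (n : nat) (n_gt0 : (0 < n)%N)
    (sigma : {rmorphism F -> 'M[F]_n}) (delta : skew_derivation sigma) :
  (forall Omega : set 'cV[F]_n, fg_pclosed delta Omega ->
     forall a : 'cV[F]_n, fg_pclosed delta (Omega `&` conj_class delta a))
  /\
  (forall (l : nat) (a : 'I_l -> 'cV[F]_n),
     (forall i j, i <> j -> ~ conj_class delta (a i) (a j)) ->
     (forall Omega : 'I_l -> set 'cV[F]_n,
        (forall i, Omega i `<=` conj_class delta (a i)) ->
        (forall i, fg_pclosed delta (Omega i)) ->
        [/\ fg_pclosed delta (\bigcup_i Omega i),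
            forall B : 'I_l -> set 'cV[F]_n,
              (forall i, pbasis delta (Omega i) (B i)) ->
              pbasis delta (\bigcup_i Omega i) (\bigcup_i B i)
          & prank delta (\bigcup_i Omega i) =
              (\sum_(i < l) prank delta (Omega i))%N])
     /\
     (let C := [set X : set 'cV[F]_n |
          fg_pclosed delta X /\ X `<=` \bigcup_i conj_class delta (a i)] in
      let K := fun i => centralizer delta (a i) in
      let D := [set L : 'I_l -> set (set F) |
          forall i, fin_dim_proj_subspace (K i) (L i)] in
      is_lattice C (psum delta) setI /\
      lattice_isomorphic C (psum delta) setI
        D (pointwise (fun i => proj_sum (K i))) (pointwise (fun _ => setI)))).
Proof.
split=> [Omega [_ [G Gf [_ <-]]] a | l a nonconj].
  rewrite (pclosure_conj divF) //; apply: fg_pclosure; exact: finite_setIl.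
split=> [Omega OC Ofg | C K D].
  split; first exact: (fg_pclosed_bigcup divF nonconj).
  - exact: (pbasis_bigcup divF nonconj).
  - exact: (prank_bigcup divF nonconj).
split; first exact: fg_pclosed_in_lattice.
exact: proj_spaces_iso.
Qed.
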